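(* Let $n>1$ and define $d:K_n\times K_n\to\{0,1,\dots,n\}$ by \[ d(x,y)=\min\{i\in\{0,1,\dots,n\}\mid \overline{\partial}_{[i]}(x)=\overline{\partial}_{[i]}(y)\}. \] Then $(K_n,d)$ is an ultrametric space.
   Context: For a natural number $k$, $[k]=\{1,\dots,k\}$, and $[0]=\emptyset$. Kiselman's semigroup $K_n$ is the monoid, with unit element $e$, given by generators $a_1,\dots,a_n$ and relations $a_i^2=a_i$ for all $i\in[n]$, and $a_i a_j a_i = a_j a_i a_j = a_i a_j$ for all $1\le j<i\le n$. For $X\subseteq[n]$, the deletion endomorphism $\overline{\partial}_X:K_n\to K_n$ is the unique monoid endomorphism with $\overline{\partial}_X(a_i)=a_i$ if $i\notin X$ and $\overline{\partial}_X(a_i)=e$ if $i\in X$. The minimum defining $d$ exists because $\overline{\partial}_{[n]}$ maps every element to $e$. An ultrametric is a metric satisfying $d(x,y)\le\max\{d(x,z),d(z,y)\}$. *)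

(* Defs.v *)
From HB Require Import structures.
From mathcomp Require Import all_boot all_order all_algebra.
From mathcomp Require Import boolp reals.

Set Implicit Arguments.
Unset Strict Implicit.
Unset Printing Implicit Defensive.

Local Open Scope quotient_scope.
Local Open Scope group_scope.

(* Generators are indexed from 0: the letter [k : 'I_n] stands for a_(k+1).   *)
(* The shift preserves the order of the indices, hence the relations.         *)
Inductive kiselman_relator (n : nat) : seq 'I_n -> seq 'I_n -> Prop :=
| KRidem (i : 'I_n) : kiselman_relator [:: i; i] [:: i]
| KRiji (i j : 'I_n) : (j < i)%N -> kiselman_relator [:: i; j; i] [:: i; j]
| KRjij (i j : 'I_n) : (j < i)%N -> kiselman_relator [:: j; i; j] [:: i; j].

Inductive kiselman_congr (n : nat) : seq 'I_n -> seq 'I_n -> Prop :=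
| KCrel u v : kiselman_relator u v -> kiselman_congr u v
| KCrefl u : kiselman_congr u u
| KCsym u v : kiselman_congr u v -> kiselman_congr v u
| KCtrans u v w : kiselman_congr u v -> kiselman_congr v w -> kiselman_congr u w
| KCcat u u' v v' : kiselman_congr u u' -> kiselman_congr v v' ->
    kiselman_congr (u ++ v) (u' ++ v').

Definition kiselman_congrb (n : nat) : rel (seq 'I_n) :=
  fun u v => `[< kiselman_congr u v >].

Lemma kiselman_congrb_refl n : reflexive (@kiselman_congrb n).
Proof. by move=> u; apply/asboolP/KCrefl. Qed.

Lemma kiselman_congrb_sym n : symmetric (@kiselman_congrb n).
Proof. by move=> u v; apply/asboolP/asboolP => /KCsym. Qed.

Lemma kiselman_congrb_trans n : transitive (@kiselman_congrb n).
Proof.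
by move=> v u w /asboolP uv /asboolP vw; apply/asboolP; apply: KCtrans uv vw.
Qed.

Canonical kiselman_equiv n := EquivRel (@kiselman_congrb n)
  (@kiselman_congrb_refl n) (@kiselman_congrb_sym n) (@kiselman_congrb_trans n).

Definition kiselman (n : nat) : Type := {eq_quot (@kiselman_equiv n)}.

HB.instance Definition _ n := Choice.on (kiselman n).
HB.instance Definition _ n := EqQuotient.on (kiselman n).

Lemma kiselman_piP n (u v : seq 'I_n) :
  \pi_(kiselman n) u = \pi_(kiselman n) v <-> kiselman_congr u v.
Proof.
split=> [/eqmodP /asboolP //|uv].
by apply/eqmodP/asboolP.
Qed.

Lemma kiselman_reprP n (u : seq 'I_n) :
  kiselman_congr (repr (\pi_(kiselman n) u)) u.
Proof. by apply/kiselman_piP; rewrite reprK. Qed.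

Definition kiselman_mul n (x y : kiselman n) : kiselman n :=
  \pi_(kiselman n) (repr x ++ repr y).

Definition kiselman_one n : kiselman n := \pi_(kiselman n) [::].

Lemma kiselman_mul_pi n (u v : seq 'I_n) :
  kiselman_mul (\pi_(kiselman n) u) (\pi_(kiselman n) v)
  = \pi_(kiselman n) (u ++ v).
Proof. by apply/kiselman_piP/KCcat; apply: kiselman_reprP. Qed.

Lemma kiselman_mulA n : associative (@kiselman_mul n).
Proof.
move=> x y z; rewrite -[x]reprK -[y]reprK -[z]reprK.
rewrite [X in kiselman_mul _ X]kiselman_mul_pi [LHS]kiselman_mul_pi.
rewrite [X in kiselman_mul X _]kiselman_mul_pi [RHS]kiselman_mul_pi.
by rewrite catA.
Qed.

Lemma kiselman_mul1 n : left_id (kiselman_one n) (@kiselman_mul n).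
Proof. by move=> x; rewrite -[x]reprK [LHS]kiselman_mul_pi. Qed.

Lemma kiselman_mulr1 n : right_id (kiselman_one n) (@kiselman_mul n).
Proof. by move=> x; rewrite -[x]reprK [LHS]kiselman_mul_pi cats0. Qed.

HB.instance Definition _ n := isMonoid.Build (kiselman n)
  (@kiselman_mulA n) (@kiselman_mul1 n) (@kiselman_mulr1 n).

Definition kiselman_gen n (i : 'I_n) : kiselman n := \pi_(kiselman n) [:: i].

Lemma kiselman_pi_prod n (u : seq 'I_n) :
  \pi_(kiselman n) u = \prod_(i <- u) kiselman_gen i.
Proof.
elim: u => [|i u IH]; first by rewrite big_nil.
by rewrite big_cons -IH -[i :: u]cat1s -kiselman_mul_pi.
Qed.

Lemma kiselman_genK n (i : 'I_n) :
  kiselman_gen i * kiselman_gen i = kiselman_gen i.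
Proof.
by rewrite [LHS]kiselman_mul_pi; apply/kiselman_piP/KCrel/KRidem.
Qed.

Lemma kiselman_gen_iji n (i j : 'I_n) : (j < i)%N ->
  kiselman_gen i * kiselman_gen j * kiselman_gen i
  = kiselman_gen i * kiselman_gen j.
Proof.
move=> ji; rewrite /kiselman_gen [X in X * _]kiselman_mul_pi.
by rewrite [LHS]kiselman_mul_pi [RHS]kiselman_mul_pi;
  apply/kiselman_piP/KCrel/KRiji.
Qed.

Lemma kiselman_gen_jij n (i j : 'I_n) : (j < i)%N ->
  kiselman_gen j * kiselman_gen i * kiselman_gen j
  = kiselman_gen i * kiselman_gen j.
Proof.
move=> ji; rewrite /kiselman_gen [X in X * _]kiselman_mul_pi.
by rewrite [LHS]kiselman_mul_pi [RHS]kiselman_mul_pi;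
  apply/kiselman_piP/KCrel/KRjij.
Qed.

Definition deletion n (X : {set 'I_n}) (x : kiselman n) : kiselman n :=
  \prod_(i <- repr x) (if i \in X then 1 else kiselman_gen i).

Lemma deletion_congr n (X : {set 'I_n}) (u v : seq 'I_n) :
    kiselman_congr u v ->
  \prod_(i <- u) (if i \in X then 1 else kiselman_gen i)
  = \prod_(i <- v) (if i \in X then 1 else kiselman_gen i).
Proof.
elim=> {u v} [_ _ []|//|u v _ ->//|u v w _ -> _ ->//|u u' v v' _ e1 _ e2].
- move=> i; rewrite !big_cons big_nil !mulg1.
  by case: ifP; rewrite ?mulg1 ?kiselman_genK.
- move=> i j ji; rewrite !big_cons big_nil !mulg1.
  case: (i \in X); case: (j \in X); rewrite ?mul1g ?mulg1 ?kiselman_genK //.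
  by rewrite mulgA kiselman_gen_iji.
- move=> i j ji; rewrite !big_cons big_nil !mulg1.
  case: (i \in X); case: (j \in X); rewrite ?mul1g ?mulg1 ?kiselman_genK //.
  by rewrite mulgA kiselman_gen_jij.
- by rewrite !big_cat e1 e2.
Qed.

Lemma deletion_pi n (X : {set 'I_n}) (u : seq 'I_n) :
  deletion X (\pi_(kiselman n) u)
  = \prod_(i <- u) (if i \in X then 1 else kiselman_gen i).
Proof. exact/deletion_congr/kiselman_reprP. Qed.

Lemma deletion_morphism n (X : {set 'I_n}) : monoid_morphism (deletion X).
Proof.
split=> [|x y]; first by rewrite deletion_pi big_nil.
rewrite -[x]reprK -[y]reprK [X in deletion _ X]kiselman_mul_pi !deletion_pi.
by rewrite big_cat.
Qed.

HB.instance Definition _ n (X : {set 'I_n}) :=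
  isUMagmaMorphism.Build (kiselman n) (kiselman n) (deletion X)
    (deletion_morphism X).

Lemma deletion_gen n (X : {set 'I_n}) (i : 'I_n) :
  deletion X (kiselman_gen i) = if i \in X then 1 else kiselman_gen i.
Proof. by rewrite deletion_pi big_seq1. Qed.

Lemma deletion_unique n (X : {set 'I_n}) (f : kiselman n -> kiselman n) :
    monoid_morphism f ->
    (forall i, f (kiselman_gen i) = if i \in X then 1 else kiselman_gen i) ->
  f =1 deletion X.
Proof.
move=> [f1 fM] fg x; rewrite -[x]reprK deletion_pi kiselman_pi_prod.
by rewrite (big_morph f fM f1); apply: eq_bigr.
Qed.

(* The set [i] = {1, ..., i}, with the indices shifted as above.              *)
Definition initial n (i : nat) : {set 'I_n} := [set k : 'I_n | (k < i)%N].

Lemma deletion_initial_max n (x y : kiselman n) :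
  deletion (initial n (@ord_max n)) x == deletion (initial n (@ord_max n)) y.
Proof.
have E z : deletion (initial n n) z = 1.
  by apply: big1_seq => i _; rewrite inE ltn_ord.
by rewrite /= !E.
Qed.

(* [deletion_initial_max] says that the seed [ord_max] of [arg min] satisfies *)
(* the condition, so this is a genuine minimum and not a default value.       *)
Definition kiselman_dist n (x y : kiselman n) : 'I_n.+1 :=
  [arg min_(i < ord_max |
      deletion (initial n i) x == deletion (initial n i) y) (i : nat)].

Lemma kiselman_distP n (x y : kiselman n) :
  deletion (initial n (kiselman_dist x y)) x
    = deletion (initial n (kiselman_dist x y)) y
  /\ forall i : 'I_n.+1, deletion (initial n i) x = deletion (initial n i) y ->
       (kiselman_dist x y <= i)%N.
Proof.
rewrite /kiselman_dist; case: arg_minnP => [|i /eqP xyi imin].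
  exact: deletion_initial_max.
by split=> // j /eqP /imin.
Qed.

Local Open Scope ring_scope.

Record is_metric (R : realType) (T : Type) (d : T -> T -> R) : Prop := IsMetric {
  metric_ge0 : forall x y, 0 <= d x y;
  metric_eq0 : forall x y, d x y = 0 <-> x = y;
  metric_sym : forall x y, d x y = d y x;
  metric_triangle : forall x y z, d x y <= d x z + d z y
}.

Record is_ultrametric (R : realType) (T : Type) (d : T -> T -> R) : Prop :=
  IsUltrametric {
    ultrametric_metric : is_metric d;
    ultrametric_le_max : forall x y z, d x y <= Num.max (d x z) (d z y)
  }.

(* Main.v *)
Require Import Defs.
From mathcomp Require Import all_boot all_order all_algebra.
From mathcomp Require Import reals.

(* Deletions compose by union, so once the deletions along [i] identify two   *)
(* elements, so do all those along [j] with [i <= j]; hence [d x y <= i] is   *)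
(* the equivalence relation "the deletions of x and y along [i] agree", and   *)
(* its transitivity is the ultrametric inequality.                            *)

Import GRing.Theory Num.Theory.

Local Open Scope ring_scope.

(** Everything is read off [kiselman_dist_leP]: separation is its case [i = 0], where nothing is
    deleted, and symmetry is that of equality. The ordinary triangle inequality then follows from
    the ultrametric one. *)

Lemma deletion_comp {n} (X Y : {set 'I_n}) (x : kiselman n) :
  deletion X (deletion Y x) = deletion (X :|: Y) x.
Proof.
have [[X1 XM] [Y1 YM]] := (deletion_morphism X, deletion_morphism Y).
(* An endomorphism is determined by its values on the generators. *)
apply: (@deletion_unique _ _ (deletion X \o deletion Y)) => [|i] /=.
  by split=> [|y z] /=; rewrite ?Y1 ?X1 // YM XM.
by rewrite deletion_gen inE orbC; case: ifP; rewrite ?X1 ?deletion_gen.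
Qed.

Lemma deletion_initial_le {n} (i j : nat) (x y : kiselman n) : (i <= j)%N ->
  deletion (initial n i) x = deletion (initial n i) y ->
  deletion (initial n j) x = deletion (initial n j) y.
Proof.
move=> ij e; suff <- : initial n j :|: initial n i = initial n j.
  by rewrite -!deletion_comp e.
by apply/setUidPl/subsetP => k; rewrite !inE => /leq_trans; apply.
Qed.

Lemma deletion_initial0 {n} (x : kiselman n) : deletion (initial n 0) x = x.
Proof. by apply/esym/(@deletion_unique _ _ id) => // i; rewrite inE. Qed.

(** Minimality gives the direction from right to left; the other propagates agreement from the
    minimum up to [i] by [deletion_initial_le]. *)
Lemma kiselman_dist_leP {n} (x y : kiselman n) (i : 'I_n.+1) :
  (kiselman_dist x y <= i)%N <->
  deletion (initial n i) x = deletion (initial n i) y.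
Proof.
have [e dmin] := kiselman_distP x y.
by split=> [/deletion_initial_le|/dmin//]; apply.
Qed.

Lemma kiselman_dist_eq0 {n} (x y : kiselman n) :
  (kiselman_dist x y : nat) = 0%N <-> x = y.
Proof.
have := kiselman_dist_leP x y ord0; rewrite !deletion_initial0 leqn0.
by move=> [d0 xy]; split=> [/eqP/d0|/xy/eqP].
Qed.

Lemma kiselman_distC {n} (x y : kiselman n) :
  kiselman_dist x y = kiselman_dist y x.
Proof.
by apply/val_inj/anti_leq/andP; split;
  apply/kiselman_dist_leP/esym/kiselman_dist_leP.
Qed.

Lemma kiselman_dist_le_max {n} (x y z : kiselman n) :
  (kiselman_dist x y <= maxn (kiselman_dist x z) (kiselman_dist z y))%N.
Proof.
(* The maximum has to be an index in ['I_n.+1] before [kiselman_dist_leP] applies to it. *)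
have lt_max : (maxn (kiselman_dist x z) (kiselman_dist z y) < n.+1)%N.
  by rewrite gtn_max !ltn_ord.
apply/(kiselman_dist_leP x y (Ordinal lt_max)).
rewrite ((kiselman_dist_leP x z (Ordinal lt_max)).1 (leq_maxl _ _)).
exact: ((kiselman_dist_leP z y (Ordinal lt_max)).1 (leq_maxr _ _)).
Qed.

Theorem theorem7p1 (R : realType) (n : nat) (hn : (1 < n)%N) :
  is_ultrametric (fun x y : kiselman n => (kiselman_dist x y : nat)%:R : R).
Proof.
split; first split.
- by move=> x y; apply: ler0n.
- move=> x y; rewrite -kiselman_dist_eq0; split=> [/eqP|->//].
  by rewrite pnatr_eq0 => /eqP.
- by move=> x y; rewrite kiselman_distC.
- move=> x y z; rewrite -natrD ler_nat.
  apply: leq_trans (kiselman_dist_le_max x y z) _.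
  by rewrite geq_max leq_addr leq_addl.
- by move=> x y z; rewrite -natr_max ler_nat kiselman_dist_le_max.
Qed.
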